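(* Let $P$ be a naturally labeled poset on $\{1,\ldots,n\}$ and let $C_1,\ldots,C_h$ be the connected components of $G_P$. Then \[F_P(\mathbf{x})=\prod_{r=1}^h\sum_{M_r\in\mathscr{M}(C_r)}\frac{\prod_{J\in\overline{\mathrm{Des}}(M_r)}\prod_{k\in J}x_k}{\prod_{J\in M_r}\bigl(1-\prod_{j\in J}x_j\bigr)},\] where $\mathscr{M}(C_r)$ is the set of maximum independent sets of $C_r$.
   Context: $P$ is a partial order $\leq_P$ on $[n]$; naturally labeled means $i<_P j\Rightarrow i<j$. A $P$-partition is a map $f:[n]\to\mathbb{N}=\{0,1,2,\ldots\}$ such that $i<_P j$ implies $f(i)\ge f(j)$, and $i<_P j$ with $i>j$ implies $f(i)>f(j)$. $F_P(\mathbf{x})=\sum_f x_1^{f(1)}\cdots x_n^{f(n)}$ (formal power series), summing over all $P$-partitions. An order ideal is a subset $J$ with $i\in J$, $j\le_P i\Rightarrow j\in J$; a nonempty order ideal is connected if the Hasse diagram of $P$ restricted to it is connected. Sets $A,B$ intersect nontrivially if $A\cap B\neq\emptyset$, $A\not\subseteq B$, $B\not\subseteq A$. $G_P$ is the simple graph whose vertices are the connected order ideals of $P$, adjacent iff they intersect nontrivially; $V(C)$ is the vertex set of a subgraph $C$. A maximum independent set is an independent set of largest possible size. For a maximum independent set $M$ of $G_P$ and $J\in M$, $\mu(M,J)=\bigcup_{J'\in M,\,J'\subsetneq J}J'$; each $J\setminus\mu(M,J)$ is a singleton and distinct $J$ give distinct elements (fact from the paper), so each $i\in[n]$ has a unique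 $J_i\in M$ with $J_i\setminus\mu(M,J_i)=\{i\}$. $F_M$ is the poset on $[n]$ with $i<_{F_M}j$ iff $J_i\subsetneq J_j$; it is a forest, and the parent of $i$ is the element covering it. $\mathrm{Des}(M)=\{i : \text{the parent } j \text{ of } i \text{ in } F_M \text{ satisfies } i>j\}$. For $M_r\in\mathscr{M}(C_r)$, choose any maximum independent set $M$ of $G_P$ with $M\cap V(C_r)=M_r$ and set $\mathrm{Des}(M_r)=\{i\in\mathrm{Des}(M):\{i\}=J\setminus\mu(M,J)\text{ for some }J\in M_r\}$, $\overline{\mathrm{Des}}(M_r)=\{J\in M_r: J\setminus\mu(M,J)=\{i\}\text{ for some }i\in\mathrm{Des}(M_r)\}$; for naturally labeled $P$ these do not depend on the choice of $M$. *)

(* Defs.v *)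
From HB Require Import structures.
From mathcomp Require Import all_boot all_order all_algebra.
From mathcomp Require Import boolp mpoly.

Set Implicit Arguments.
Unset Strict Implicit.
Unset Printing Implicit Defensive.

Import GRing.Theory.
Local Open Scope ring_scope.

(** * The ring Z[[x_1, ..., x_n]] *)

(* A formal power series is its family of integer coefficients, indexed by
   the exponent vectors 'X_{1..n} of multinomials. The variables are indexed
   by 'I_n, so x_(i+1) is mps_var i. *)
Record mps (n : nat) := Mps { mps_coef : 'X_{1..n} -> int }.

HB.instance Definition _ n := [isNew for @mps_coef n].
HB.instance Definition _ n := [Choice of mps n by <:].

Lemma mpsP n (f g : mps n) : mps_coef f =1 mps_coef g -> f = g.
Proof. by case: f g => [f] [g] /funext/= ->. Qed.

Definition mps0 n : mps n := Mps (fun _ => 0).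
Definition mps1 n : mps n := Mps (fun m => (m == 0%MM)%:R).
Definition mps_opp n (f : mps n) : mps n := Mps (fun m => - mps_coef f m).
Definition mps_add n (f g : mps n) : mps n :=
  Mps (fun m => mps_coef f m + mps_coef g m).
Definition mps_mul n (f g : mps n) : mps n :=
  Mps (fun m =>
    \sum_(k : 'X_{1..n < (mdeg m).+1, (mdeg m).+1} | m == (k.1 + k.2)%MM)
      mps_coef f k.1 * mps_coef g k.2).

Lemma mps_addA n : associative (@mps_add n).
Proof. by move=> f g h; apply/mpsP => m /=; rewrite addrA. Qed.
Lemma mps_addC n : commutative (@mps_add n).
Proof. by move=> f g; apply/mpsP => m /=; rewrite addrC. Qed.
Lemma mps_add0 n : left_id (@mps0 n) (@mps_add n).
Proof. by move=> f; apply/mpsP => m /=; rewrite add0r. Qed.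
Lemma mps_addN n : left_inverse (@mps0 n) (@mps_opp n) (@mps_add n).
Proof. by move=> f; apply/mpsP => m /=; rewrite addNr. Qed.

HB.instance Definition _ n :=
  GRing.isZmodule.Build (mps n) (@mps_addA n) (@mps_addC n) (@mps_add0 n)
    (@mps_addN n).

(* The ring laws are transported from {mpoly int[n]} by truncation. *)
Definition mps_trunc n (d : nat) (f : mps n) : {mpoly int[n]} :=
  \sum_(m : 'X_{1..n < d}) mps_coef f m *: 'X_[m].

Lemma mps_truncE n d (f : mps n) (m : 'X_{1..n}) :
  (mdeg m < d)%N -> (mps_trunc d f)@_m = mps_coef f m.
Proof. exact: mcoeff_mpoly. Qed.

Lemma mps_coef_mpoly n (f g : mps n) (p q : {mpoly int[n]}) (m : 'X_{1..n}) :
  (forall k, (mdeg k <= mdeg m)%N -> p@_k = mps_coef f k) ->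
  (forall k, (mdeg k <= mdeg m)%N -> q@_k = mps_coef g k) ->
  mps_coef (mps_mul f g) m = (p * q)@_m.
Proof.
move=> pf qg; rewrite mcoeffM /=; apply: eq_bigr => -[k l] /= _.
by rewrite pf ?qg // -ltnS bmdeg.
Qed.

Lemma mps_mulE n (f g : mps n) d (m : 'X_{1..n}) : (mdeg m < d)%N ->
  mps_coef (mps_mul f g) m = (mps_trunc d f * mps_trunc d g)@_m.
Proof.
by move=> md; apply: mps_coef_mpoly => k km;
  rewrite mps_truncE // (leq_ltn_trans km).
Qed.

Lemma mps_mulC n : commutative (@mps_mul n).
Proof.
by move=> f g; apply/mpsP => m; rewrite !(mps_mulE _ _ (ltnSn _)) mulrC.
Qed.

Lemma mps_mulA n : associative (@mps_mul n).
Proof.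
move=> f g h; apply/mpsP => m; pose t := mps_trunc (mdeg m).+1 (n:=n).
rewrite (@mps_coef_mpoly _ _ _ (t f) (t g * t h)); last 2 first.
- by move=> k km; rewrite mps_truncE.
- by move=> k km; rewrite -mps_mulE.
rewrite (@mps_coef_mpoly _ _ _ (t f * t g) (t h)) ?mulrA //.
- by move=> k km; rewrite -mps_mulE.
- by move=> k km; rewrite mps_truncE.
Qed.

Lemma mps_mul1 n : left_id (@mps1 n) (@mps_mul n).
Proof.
move=> f; apply/mpsP => m.
rewrite (@mps_coef_mpoly _ _ _ 1 (mps_trunc (mdeg m).+1 f)).
- by rewrite mul1r mps_truncE.
- by move=> k _; rewrite mcoeff1.
- by move=> k km; rewrite mps_truncE.
Qed.

Lemma mps_mulDl n : left_distributive (@mps_mul n) (@mps_add n).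
Proof.
move=> f g h; apply/mpsP => m /=; rewrite -big_split /=.
by apply: eq_bigr => k _; rewrite mulrDl.
Qed.

Lemma mps1_neq0 n : mps1 n != 0.
Proof. by apply/eqP => /(congr1 (fun f => mps_coef f 0%MM)) /=; rewrite eqxx. Qed.

HB.instance Definition _ n :=
  GRing.Zmodule_isComNzRing.Build (mps n) (@mps_mulA n) (@mps_mulC n)
    (@mps_mul1 n) (@mps_mulDl n) (mps1_neq0 n).

Definition mps_unit n : {pred mps n} :=
  fun f => `[< exists g : mps n, g * f = 1 >].
Definition mps_inv n (f : mps n) : mps n :=
  if pselect (exists g : mps n, g * f = 1) is left e then projT1 (cid e) else f.

Lemma mps_mulV n : {in @mps_unit n, left_inverse 1 (@mps_inv n) *%R}.
Proof.
move=> f /asboolP ex; rewrite /mps_inv.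
by case: pselect => // e; case: (cid e).
Qed.
Lemma mps_unitPl n (f g : mps n) : g * f = 1 -> mps_unit f.
Proof. by move=> gf; apply/asboolP; exists g. Qed.
Lemma mps_inv_out n : {in [predC @mps_unit n], @mps_inv n =1 id}.
Proof. by move=> f /asboolPn ne; rewrite /mps_inv; case: pselect. Qed.

HB.instance Definition _ n :=
  GRing.ComNzRing_hasMulInverse.Build (mps n) (@mps_mulV n) (@mps_unitPl n)
    (@mps_inv_out n).

Definition mps_mono n (a : 'X_{1..n}) : mps n := Mps (fun m => (m == a)%:R).
Definition mps_var n (i : 'I_n) : mps n := mps_mono U_(i)%MM.

Lemma mps_coef_sum n (I : Type) (r : seq I) (A : pred I) (F : I -> mps n) m :
  mps_coef (\sum_(i <- r | A i) F i) m = \sum_(i <- r | A i) mps_coef (F i) m.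
Proof. exact: (big_morph (fun f : mps n => mps_coef f m)). Qed.

Lemma mps_monoD n (a b : 'X_{1..n}) :
  mps_mono (a + b)%MM = mps_mono a * mps_mono b.
Proof.
apply/mpsP => m; rewrite (@mps_coef_mpoly _ _ _ 'X_[a] 'X_[b]).
- by rewrite -mpolyXD mcoeffX eq_sym.
- by move=> k _; rewrite mcoeffX eq_sym.
- by move=> k _; rewrite mcoeffX eq_sym.
Qed.

Lemma mps_mono0 n : mps_mono 0%MM = 1 :> mps n.
Proof. by []. Qed.

Lemma mps_monoE n (a : 'X_{1..n}) :
  mps_mono a = \prod_(i < n) mps_var i ^+ a i.
Proof.
have monoX (b : 'X_{1..n}) k : mps_mono (b *+ k)%MM = mps_mono b ^+ k.
  elim: k => [|k IH]; first by rewrite mulm0n expr0.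
  by rewrite mulmS exprS mps_monoD IH.
rewrite {1}(multinomUE_id a) (big_morph _ (@mps_monoD n) (@mps_mono0 n)).
by apply: eq_bigr => i _; rewrite monoX.
Qed.

(* A series with zero constant term can be subtracted from 1 to give a unit,
   so all the denominators of the generating function are invertible. *)
Lemma mps_subr_unit n (u : mps n) : mps_coef u 0%MM = 0 -> 1 - u \is a GRing.unit.
Proof.
move=> u0.
have uX k m : (mdeg m < k)%N -> mps_coef (u ^+ k) m = 0.
  elim: k m => // k IH m mk; rewrite exprS /= big1 // => -[a b] /= /eqP/(congr1 (@mdeg n)).
  rewrite mdegD => mE.
  have [a0|a_n0] := eqVneq (bmnm a) 0%MM; first by rewrite a0 u0 mul0r.
  rewrite IH ?mulr0 //; move: mk; rewrite {1}mE ltnS.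
  by apply: leq_trans; rewrite -[X in (X < _)%N]add0n ltn_add2r lt0n mdeg_eq0.
pose S d := \sum_(k < d) u ^+ k.
have SE d m : (mdeg m < d)%N ->
    mps_coef (S d) m = mps_coef (S (mdeg m).+1) m.
  move=> /subnKC <-; elim: (d - _)%N => [|e IH]; first by rewrite addn0.
  rewrite addnS {1}/S big_ord_recr /= -/(S _) IH uX ?addr0 //.
  by rewrite addSn ltnS leq_addr.
pose g : mps n := Mps (fun m => mps_coef (S (mdeg m).+1) m).
apply/unitrPr; exists g; apply/mpsP => m.
have -> : mps_coef ((1 - u) * g) m = mps_coef ((1 - u) * S (mdeg m).+1) m.
  apply: eq_bigr => -[a b] /= _; congr (_ * _).
  by rewrite [RHS]SE ?bmdeg.
rewrite -opprB mulNr -subrX1 opprB /= uX //.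
by rewrite subr0.
Qed.

(** * Labeled posets *)

(* A partial order on [n] is a relation le on 'I_n; the shift of the labels
   from {1, ..., n} to {0, ..., n-1} preserves their natural order. *)
Definition strict n (le : rel 'I_n) : rel 'I_n :=
  [rel i j | (i != j) && le i j].

Definition naturally_labeled n (le : rel 'I_n) : Prop :=
  forall i j : 'I_n, strict le i j -> (i < j)%N.

Definition covers n (lt : rel 'I_n) : rel 'I_n :=
  [rel i j | lt i j && ~~ [exists k, lt i k && lt k j]].

Definition P_partition n (le : rel 'I_n) (f : 'I_n -> nat) : bool :=
  [forall i, forall j, strict le i j ==>
     (f j <= f i)%N && ((j < i)%N ==> (f j < f i)%N)].

(* P-partitions and monomials are both maps from [n] to nat, so the formal
   sum of x^f over all P-partitions f has coefficient 1 at x^m if m is a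
   P-partition, and 0 otherwise; see FP_sum. *)
Definition FP n (le : rel 'I_n) : mps n :=
  Mps (fun m => (P_partition le m)%:R).

Lemma FP_sum n (le : rel 'I_n) (d : nat) (m : 'X_{1..n}) : (mdeg m < d)%N ->
  mps_coef (\sum_(f : 'X_{1..n < d} | P_partition le f)
              \prod_(i < n) mps_var i ^+ f i) m = mps_coef (FP le) m.
Proof.
move=> md; rewrite mps_coef_sum /= big_mkcond (bigD1 (BMultinom md)) //=.
rewrite -mps_monoE /= eqxx big1 ?addr0; first by case: (P_partition le m).
move=> f fm; rewrite -mps_monoE /=; case: ifP => // _.
by move: fm; rewrite bmeqP /= eq_sym => /negbTE ->.
Qed.

Definition order_ideal n (le : rel 'I_n) (J : {set 'I_n}) : bool :=
  [forall i in J, forall j, le j i ==> (j \in J)].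

Definition hasse_in n (le : rel 'I_n) (J : {set 'I_n}) : rel 'I_n :=
  [rel i j | [&& i \in J, j \in J &
     covers (strict le) i j || covers (strict le) j i]].

Definition connected_ideal n (le : rel 'I_n) (J : {set 'I_n}) : bool :=
  [&& J != set0, order_ideal le J &
      [forall i in J, forall j in J, connect (hasse_in le J) i j]].

(** * Finite simple graphs, given by a vertex set V and adjacency relation e *)

Definition components (T : finType) (V : {set T}) (e : rel T) : {set {set T}} :=
  equivalence_partition
    (connect [rel x y | [&& x \in V, y \in V & e x y]]) V.

Definition independent (T : finType) (V : {set T}) (e : rel T) (M : {set T}) :=
  (M \subset V) && [forall x in M, forall y in M, ~~ e x y].

Definition max_independent (T : finType) (V : {set T}) (e : rel T) :
    {set {set T}} :=
  [set M | independent V e M &&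
     [forall M' : {set T}, independent V e M' ==> (#|M'| <= #|M|)%N]].

(** * The graph G_P and descents *)

Definition GP_vertices n (le : rel 'I_n) : {set {set 'I_n}} :=
  [set J | connected_ideal le J].

Definition GP_edge n : rel {set 'I_n} :=
  [rel A B | [&& A :&: B != set0, ~~ (A \subset B) & ~~ (B \subset A)]].

Definition GP_components n (le : rel 'I_n) : {set {set {set 'I_n}}} :=
  components (GP_vertices le) (@GP_edge n).

Definition mu n (M : {set {set 'I_n}}) (J : {set 'I_n}) : {set 'I_n} :=
  \bigcup_(J' in M | J' \proper J) J'.

(* If M is a maximum independent set of G_P, exactly one J in M satisfies the
   condition below, and the default value is not used. *)
Definition ideal_of n (M : {set {set 'I_n}}) (i : 'I_n) : {set 'I_n} :=
  odflt set0 [pick J in M | J :\: mu M J == [set i]].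

Definition forest_lt n (M : {set {set 'I_n}}) : rel 'I_n :=
  [rel i j | ideal_of M i \proper ideal_of M j].

Definition Des n (M : {set {set 'I_n}}) : {set 'I_n} :=
  [set i : 'I_n | [exists j : 'I_n, covers (forest_lt M) i j && (j < i)%N]].

(* In the next two definitions M is a maximum independent set of G_P that
   extends the maximum independent set Mr of a component. *)
Definition Des_in n (M Mr : {set {set 'I_n}}) : {set 'I_n} :=
  [set i in Des M | [exists J in Mr, [set i] == J :\: mu M J]].

Definition Desbar_in n (M Mr : {set {set 'I_n}}) : {set {set 'I_n}} :=
  [set J in Mr | [exists i in Des_in M Mr, J :\: mu M J == [set i]]].

(* M is a choice, for each component C and each maximum independent set Mr of
   C, of a maximum independent set of G_P that meets C exactly in Mr. *)
Definition extension_choice n (le : rel 'I_n)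
    (M : {set {set 'I_n}} -> {set {set 'I_n}} -> {set {set 'I_n}}) : Prop :=
  forall C Mr, C \in GP_components le -> Mr \in max_independent C (@GP_edge n) ->
    M C Mr \in max_independent (GP_vertices le) (@GP_edge n) /\
    M C Mr :&: C = Mr.

Lemma max_independent_extend (T : finType) (V : {set T}) (e : rel T)
    (C Mr : {set T}) : ssrbool.symmetric e ->
  C \in components V e -> Mr \in max_independent C e ->
  exists2 M, M \in max_independent V e & M :&: C = Mr.
Proof.
move=> e_sym CV MrC.
set e' := [rel x y | [&& x \in V, y \in V & e x y]].
have e'_sym : connect_sym e'.
  by apply: sym_connect_sym => x y; rewrite /= e_sym andbCA.
have eqvP : {in V & &, equivalence_rel (connect e')}.
  move=> x y z _ _ _; split; first exact: connect0.
  by move=> xy; apply: same_connect.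
have part := equivalence_partitionP eqvP; rewrite -/(components V e) in part.
have trivV := partition_trivIset part.
have compE D D' x y : D \in components V e -> D' \in components V e ->
    x \in D -> y \in D' -> e x y -> D = D'.
  move=> DV D'V xD yD' exy.
  have subV B z : B \in components V e -> z \in B -> z \in V.
    by move=> BV zB; rewrite -(cover_partition part); apply/bigcupP; exists B.
  have yV := subV _ _ D'V yD'; have xV := subV _ _ DV xD.
  rewrite -(def_pblock trivV DV xD) -(def_pblock trivV D'V yD').
  apply/eqP; rewrite eq_pblock ?(cover_partition part) //.
  by rewrite (pblock_equivalence_partition eqvP) //; apply: connect1; rewrite /= xV yV.
have exmax (D : {set T}) : exists M, M \in max_independent D e.
  have i0 : independent D e set0.
    by rewrite /independent sub0set; apply/forall_inP => x; rewrite inE.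
  have [M iM maxM] := @arg_maxnP _ set0 (independent D e) (fun M => #|M|) i0.
  by exists M; rewrite inE iM; apply/forallP => M'; apply/implyP => /maxM.
pose N D := if D == C then Mr else xchoose (exmax D).
have NP D : N D \in max_independent D e.
  by rewrite /N; case: eqP => [->|_] //; apply: xchooseP.
have NI D : independent D e (N D) by move: (NP D); rewrite inE => /andP[].
have ND D : N D \subset D by case/andP: (NI D).
pose M := \bigcup_(D in components V e) N D.
have MD D : D \in components V e -> M :&: D = N D.
  move=> DV; apply/setP => x; rewrite inE; apply/andP/idP => [[]|xN].
    case/bigcupP => D' D'V xN xD; suff -> : D = D' by [].
    by rewrite -(def_pblock trivV DV xD)
      -(def_pblock trivV D'V (subsetP (ND D') _ xN)).
  by split; [apply/bigcupP; exists D | apply: (subsetP (ND D))].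
have DsubV D : D \in components V e -> D \subset V.
  by move=> DV; rewrite -(cover_partition part); apply: bigcup_sup.
have cardE (A : {set T}) : A \subset V ->
    #|A| = (\sum_(D in components V e) #|A :&: D|)%N.
  move=> AV; transitivity (\sum_(x in V) (x \in A))%N.
    rewrite -sum1_card big_mkcond [RHS]big_mkcond /=; apply: eq_bigr => x _.
    by have := subsetP AV x; case: (x \in A) => // [->|_] //; case: ifP.
  rewrite -{1}(cover_partition part) big_trivIset //=; apply: eq_bigr => D _.
  rewrite -[RHS]sum1_card big_mkcond [RHS]big_mkcond /=; apply: eq_bigr => x _.
  by rewrite inE andbC; case: (x \in D); case: (x \in A).
exists M; last by rewrite MD // /N eqxx.
have MV : M \subset V.
  by apply/bigcupsP => D DV; apply: subset_trans (ND D) (DsubV D DV).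
rewrite inE; apply/andP; split.
  rewrite /independent MV; apply/forall_inP => x /bigcupP[D DV xN].
  apply/forall_inP => y /bigcupP[D' D'V yN]; apply/negP => exy.
  have DD' := compE D D' x y DV D'V (subsetP (ND D) _ xN) (subsetP (ND D') _ yN) exy.
  subst D'; case/andP: (NI D) => _ /forall_inP/(_ x xN)/forall_inP/(_ y yN).
  by rewrite exy.
apply/forallP => M'; apply/implyP => /andP[M'V /forall_inP M'I].
rewrite (cardE M' M'V) (cardE M MV); apply: leq_sum => D DV; rewrite MD //.
move: (NP D); rewrite inE => /andP[_ /forallP/(_ (M' :&: D))/implyP]; apply.
rewrite /independent subsetIr; apply/forall_inP => x /setIP[xM' _].
apply/forall_inP => y /setIP[yM' _].
exact: (forall_inP (M'I x xM')).
Qed.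

Lemma extension_choice_exists n (le : rel 'I_n) :
  exists M, extension_choice le M.
Proof.
have sym : ssrbool.symmetric (@GP_edge n).
  by move=> A B; rewrite /GP_edge /= setIC [X in _ && X]andbC.
pose good C Mr M := (M \in max_independent (GP_vertices le) (@GP_edge n)) &&
  (M :&: C == Mr).
exists (fun C Mr => odflt set0 [pick M | good C Mr M]) => C Mr CV MrC.
have [M MV MC] := max_independent_extend sym CV MrC.
case: pickP => [M' /andP[? /eqP ?] //|/(_ M)].
by rewrite /good MV MC eqxx.
Qed.

(* Main.v *)
(** For a P-partition [f], order the labels by decreasing value of [f], breaking
ties by increasing label. Since P is naturally labeled this is a linear extension
of P, and the connected components of [j] in the ideals [{i | i before j}] form
the unique maximum independent set [M] of [G_P] whose forest [F_M] has this order
as a linear extension, i.e. the unique [M] for which [f] is an [F_M]-partition.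
The indicator vectors of the ideals in [M] form a lattice basis in which the
[F_M]-partitions are the points with coordinates [>= 1] on descents and [>= 0]
elsewhere, which gives the generating function of [F_M] as a single fraction.

Maximum independent sets of [G_P] are unions of maximum independent sets of its
components, so the sum over [M] becomes a product of sums once one knows that
the descents of [M] in a component [C] depend only on the part of [M] in [C]. *)

Require Import Defs.
From mathcomp Require Import all_boot all_order all_algebra.
From mathcomp Require Import mpoly zify.
Import Order.TTheory GRing.Theory Num.Theory.
Set Implicit Arguments.
Unset Strict Implicit.
Unset Printing Implicit Defensive.
Local Open Scope ring_scope.

(** * Generating functions of simplicial cones *)

Section LatticeConeSeries.

Lemma mps_coef_monoM n (a : 'X_{1..n}) (g : mps n) (m : 'X_{1..n}) :
  mps_coef (mps_mono a * g) m =
  if (a <= m)%MM then mps_coef g (m - a)%MM else 0.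
Proof.
case: ifPn => [le_am|nle_am] /=; last first.
  rewrite big1 // => -[k l] /= /eqP mkl; case: eqP => [ka|_]; last by rewrite mul0r.
  by case/negP: nle_am; rewrite mkl ka lem_addr.
have degB k : (k <= m)%MM -> (mdeg k < (mdeg m).+1)%N.
  by move=> /submK <-; rewrite mdegD ltnS leq_addl.
have le_mam : (m - a <= m)%MM.
  by apply/mnm_lepP => i; rewrite mnmBE leq_subr.
pose k0 : 'X_{1..n < (mdeg m).+1, (mdeg m).+1} :=
  (BMultinom (degB _ le_am), BMultinom (degB _ le_mam)).
rewrite (bigD1 k0) /=; last by rewrite addmC submK.
rewrite eqxx mul1r big1 ?addr0 // => -[k l] /= /andP[/eqP mkl neq].
case: eqP => [ka|_]; last by rewrite mul0r.
case/eqP: neq; congr (_, _); apply/val_inj => //=.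
by rewrite [X in (X - _)%MM]mkl ka addmC addmK.
Qed.

(** The vectors [a i] behave as a lattice basis with coordinate functions [phi]. By [phi_ge], a
    point with nonnegative coordinates and a positive [k]-th one can be lowered by [a k] without
    leaving the nonnegative orthant. *)
Variables (n : nat) (I : finType) (a : I -> 'X_{1..n}).
Variables (phi : 'X_{1..n} -> I -> int) (D : {set I}).
Hypothesis phiD : forall m m' i, phi (m + m')%MM i = phi m i + phi m' i.
Hypothesis phi_gen : forall i k, phi (a k) i = (i == k)%:R.
Hypothesis phi_inj : forall m m', phi m =1 phi m' -> m = m'.
Hypothesis phi_ge : forall m k, (forall i, 0 <= phi m i) -> 1 <= phi m k ->
  (a k <= m)%MM.

Let delta i : int := (i \in D)%:R.

(* Multiplying by [1 - x^(a k)] turns the inequality on the [k]-th coordinate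
   into an equality, so this series interpolates between the cone and its
   single lowest point. *)
Let cone (S : {set I}) : mps n := Mps (fun m =>
  [forall i, if i \in S then phi m i == delta i else delta i <= phi m i]%:R).

Lemma cone_step (S : {set I}) k : k \notin S ->
  (1 - mps_mono (a k)) * cone S = cone (k |: S).
Proof.
move=> kS; apply/mpsP => m; rewrite mulrBl mul1r.
rewrite [LHS]/= -[X in _ - X]/(mps_coef (mps_mono (a k) * cone S) m) mps_coef_monoM /=.
pose rest m' := [forall i, (i != k) ==>
  (if i \in S then phi m' i == delta i else delta i <= phi m' i)].
have split1 m' : [forall i, if i \in S then phi m' i == delta i else delta i <= phi m' i]
    = (delta k <= phi m' k) && rest m'.
  apply/forallP/andP => [H|[Hk /forallP H] i].
    by split; [have := H k; rewrite (negbTE kS) | apply/forallP => i; apply/implyP].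
  have [->|ik] := eqVneq i k; first by rewrite (negbTE kS).
  by have := H i; rewrite ik.
have -> : [forall i, if i \in k |: S then phi m i == delta i else delta i <= phi m i]
    = (phi m k == delta k) && rest m.
  apply/forallP/andP => [H|[Hk /forallP H] i].
    split; first by have := H k; rewrite !inE eqxx.
    by apply/forallP => i; apply/implyP => ik; have := H i; rewrite !inE (negbTE ik).
  have [->|ik] := eqVneq i k; first by rewrite !inE eqxx.
  by have := H i; rewrite ik !inE (negbTE ik).
rewrite split1.
have d0 i : 0 <= delta i by rewrite ler0n.
case: ifPn => [le_am|nle_am].
  (* Subtracting [a k] lowers only the [k]-th coordinate, by one, so the two indicators differ only
     where [phi m k = delta k]. *)
  have phiB i : phi (m - a k)%MM i = phi m i - (i == k)%:R.
    by rewrite -{2}(submK le_am) phiD phi_gen addrK.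
  rewrite split1 phiB eqxx.
  have -> : rest (m - a k)%MM = rest m.
    by apply: eq_forallb => i; case: (i =P k) => //= /eqP ik; rewrite phiB (negbTE ik) subr0.
  case: (rest m); rewrite ?andbF ?andbT ?subrr //.
  rewrite -[1%:R]/(1:int); move: (delta k) (phi m k) => x y.
  case: (ltrgtP x y) => [xy|xy|->]; rewrite /= ?eqxx; try lia.
rewrite subr0; congr (nat_of_bool _)%:R.
case r: (rest m); rewrite ?andbF ?andbT //.
(* If [phi m k] exceeded [delta k], it would be at least 1, and [phi_ge] would contradict
   [nle_am]. *)
apply/idP/eqP => [le_d|->] //; apply/eqP; rewrite eq_le le_d andbT leNgt.
apply: contra nle_am => lt_d; apply: phi_ge; last first.
  by have := d0 k; lia.
move=> i; have [->|ik] := eqVneq i k; first by apply: le_trans (d0 k) le_d.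
move/forallP: r => /(_ i); rewrite ik /=; case: ifP => _ => [/eqP ->|] //.
exact: le_trans.
Qed.

(** Using [cone_step] once for each index reduces the cone to its lowest point, which by [phi_inj]
    is the sum of the [a i] over [D]. *)
Lemma cone_series (F : mps n) :
  (forall m, mps_coef F m = [forall i, (i \in D)%:R <= phi m i]%:R) ->
  F = (\prod_(i in D) mps_mono (a i)) / \prod_i (1 - mps_mono (a i)).
Proof.
move=> FE; have a_n0 i : a i != 0%MM.
  (* A zero generator would give [1 = 1 + 1] by additivity of [phi]. *)
  apply/eqP => a0; have := phiD 0%MM 0%MM i.
  by rewrite addm0 -{1 2 3}a0 phi_gen eqxx.
have unit_a i : 1 - mps_mono (a i) \is a GRing.unit.
  by apply: mps_subr_unit; rewrite /= eq_sym (negbTE (a_n0 i)).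
have unit_p : \prod_i (1 - mps_mono (a i)) \is a GRing.unit.
  by rewrite unitr_prod.
apply: (mulIr unit_p); rewrite divrK //.
have {FE} -> : F = cone set0.
  apply/mpsP => m; rewrite FE /=; congr (nat_of_bool _)%:R.
  by apply: eq_forallb => i; rewrite inE.
have coneE (s : seq I) : uniq s ->
    (\prod_(i <- s) (1 - mps_mono (a i))) * cone set0 = cone [set i in s].
  elim: s => [_|k s IH /= /andP[ks us]].
    by rewrite big_nil mul1r; congr cone; apply/setP => i; rewrite !inE.
  rewrite big_cons -mulrA IH // cone_step ?inE //.
  by congr cone; apply/setP => i; rewrite !inE.
rewrite mulrC coneE ?index_enum_uniq //.
have phi0 i : phi 0%MM i = 0 by have := phiD 0%MM 0%MM i; rewrite addm0; lia.
have -> : \prod_(i in D) mps_mono (a i) = mps_mono (\sum_(i in D) a i)%MM.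
  by rewrite (big_morph _ (@mps_monoD n) (@mps_mono0 n)).
apply/mpsP => m /=; congr (nat_of_bool _)%:R.
have phiS i : phi (\sum_(i in D) a i)%MM i = delta i.
  rewrite (big_morph (phi^~ i) (fun x y => phiD x y i) (phi0 i)).
  under eq_bigr do rewrite phi_gen.
  rewrite /delta; case: (boolP (i \in D)) => iD.
    rewrite (bigD1 i) //= eqxx big1 ?addr0 // => j /andP[_]; rewrite eq_sym => /negbTE ->//.
  by rewrite big1 // => j jD; case: eqP => // ij; rewrite ij jD in iD.
apply/forallP/eqP => [H|-> i]; last by rewrite inE mem_index_enum phiS.
by apply: phi_inj => i; have := H i; rewrite inE mem_index_enum phiS => /eqP.
Qed.

End LatticeConeSeries.

(** * Maximum independent sets and components of a graph *)

Section GraphComponents.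

Variables (T : finType) (V : {set T}) (e : rel T).
Hypothesis e_sym : ssrbool.symmetric e.

Let e' := [rel x y | [&& x \in V, y \in V & e x y]].

Let e'_sym : connect_sym e'.
Proof. by apply: sym_connect_sym => x y; rewrite /= e_sym andbCA. Qed.

Let eqv_connect : {in V & &, equivalence_rel (connect e')}.
Proof.
move=> x y z _ _ _; split; first exact: connect0.
by move=> xy; apply: same_connect.
Qed.

Lemma components_partition : partition (components V e) V.
Proof. exact: equivalence_partitionP eqv_connect. Qed.

Lemma component_sub C : C \in components V e -> C \subset V.
Proof.
move=> CV; rewrite -(cover_partition components_partition).
exact: (bigcup_sup C).
Qed.

Lemma mem_componentE C x y : C \in components V e -> x \in C ->
  (y \in C) = (y \in V) && connect e' x y.
Proof.
move=> CV xC; have xV := subsetP (component_sub CV) _ xC.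
have tI := partition_trivIset components_partition.
case: (boolP (y \in V)) => [yV|yV] /=; last first.
  by apply/negbTE; apply: contra yV; apply: subsetP (component_sub CV) _.
by rewrite -(def_pblock tI CV xC) (pblock_equivalence_partition eqv_connect).
Qed.

Lemma component_edge C x y : C \in components V e ->
  x \in C -> y \in V -> e x y -> y \in C.
Proof.
move=> CV xC yV exy; rewrite (mem_componentE _ CV xC) yV connect1 //=.
by rewrite yV exy (subsetP (component_sub CV) _ xC).
Qed.

Lemma component_eq C C' x : C \in components V e -> C' \in components V e ->
  x \in C -> x \in C' -> C = C'.
Proof.
have tI := partition_trivIset components_partition.
by move=> CV C'V xC xC'; rewrite -(def_pblock tI CV xC) (def_pblock tI C'V xC').
Qed.

Lemma component_exists x : x \in V -> exists2 C, C \in components V e & x \in C.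
Proof.
rewrite -{1}(cover_partition components_partition) => /bigcupP[C CV xC].
by exists C.
Qed.

Lemma component_ind (Q : pred T) C x y : C \in components V e ->
  (forall u v, u \in C -> v \in C -> e u v -> Q u -> Q v) ->
  x \in C -> Q x -> y \in C -> Q y.
Proof.
move=> CV Qe xC Qx; rewrite (mem_componentE _ CV xC) => /andP[_ /connectP[p]].
elim: p x xC Qx => [|z p IH] x xC Qx /=; first by move=> _ ->.
case/andP => /and3P[_ zV exz] pp yl.
have zC := component_edge CV xC zV exz.
by apply: (IH z) => //; apply: Qe exz Qx.
Qed.

Lemma big_components (R : Type) (idx : R) (op : Monoid.com_law idx)
    (F : T -> R) (M : {set T}) : M \subset V ->
  \big[op/idx]_(x in M) F x =
  \big[op/idx]_(C in components V e) \big[op/idx]_(x in M :&: C) F x.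
Proof.
move=> MV; transitivity (\big[op/idx]_(x in V | x \in M) F x).
  by apply: eq_bigl => x; have := subsetP MV x; case: (x \in M) => [->|] //; rewrite andbF.
rewrite (set_partition_big_cond _ components_partition); apply: eq_bigr => C _.
by apply: eq_bigl => x; rewrite inE andbC.
Qed.

Lemma card_components (M : {set T}) : M \subset V ->
  #|M| = (\sum_(C in components V e) #|M :&: C|)%N.
Proof.
move=> MV; rewrite -sum1_card (big_components _ _ MV) /=.
by apply: eq_bigr => C _; rewrite sum1_card.
Qed.

Lemma independentP (M : {set T}) : reflect
  (M \subset V /\ {in M &, forall x y, ~~ e x y}) (independent V e M).
Proof.
apply: (iffP andP) => -[-> H]; split=> //.
  by move=> x y xM yM; move/forall_inP/(_ x xM)/forall_inP: H; apply.
by apply/forall_inP => x xM; apply/forall_inP => y yM; apply: H.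
Qed.

(** Edges never leave a component, so independence can be checked one component at a time. *)
Lemma independent_glue (N : {set T} -> {set T}) :
  (forall C, C \in components V e -> independent C e (N C)) ->
  independent V e (\bigcup_(C in components V e) N C) /\
  forall C, C \in components V e ->
    (\bigcup_(D in components V e) N D) :&: C = N C.
Proof.
move=> NI; have NS C : C \in components V e -> N C \subset C by move=> /NI/andP[].
have inC C D x : C \in components V e -> D \in components V e ->
    x \in N D -> x \in C -> C = D.
  by move=> CV DV xD xC; apply: component_eq xC (subsetP (NS _ DV) _ xD).
split; last first.
  move=> C CV; apply/setP => x; rewrite inE; apply/andP/idP => [[]|xN].
    by case/bigcupP => D DV xN xC; rewrite (inC C D x).
  by split; [apply/bigcupP; exists C | apply: (subsetP (NS C CV))].
apply/andP; split.
  by apply/bigcupsP => C CV; apply: subset_trans (NS C CV) (component_sub CV).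
apply/forall_inP => x /bigcupP[C CV xC]; apply/forall_inP => y /bigcupP[D DV yD].
apply/negP => exy; have yC : y \in C.
  apply: component_edge exy => //; first exact: subsetP (NS _ CV) _ xC.
  exact: subsetP (component_sub DV) _ (subsetP (NS _ DV) _ yD).
move: (NI C CV) => /andP[_ /forall_inP/(_ x xC)/forall_inP/(_ y)].
by rewrite exy => /(_ _)/negP; apply => //; rewrite (inC C D y).
Qed.

Lemma independent_sub C M : C \in components V e -> independent V e M ->
  independent C e (M :&: C).
Proof.
move=> CV /andP[MV /forall_inP MI]; rewrite /independent subsetIr.
apply/forall_inP => x /setIP[xM _]; apply/forall_inP => y /setIP[yM _].
exact: (forall_inP (MI x xM)).
Qed.

Lemma max_independentP (W M : {set T}) : reflect
  (independent W e M /\ forall M', independent W e M' -> (#|M'| <= #|M|)%N)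
  (M \in max_independent W e).
Proof.
rewrite inE; apply: (iffP andP) => -[MI H]; split=> //.
  by move=> M' M'I; move/forallP/(_ M')/implyP: H; apply.
by apply/forallP => M'; apply/implyP/H.
Qed.

Lemma max_independent_glue (N : {set T} -> {set T}) :
  (forall C, C \in components V e -> N C \in max_independent C e) ->
  \bigcup_(C in components V e) N C \in max_independent V e /\
  forall C, C \in components V e ->
    (\bigcup_(D in components V e) N D) :&: C = N C.
Proof.
move=> NM.
have [|UI UC] := independent_glue (N := N).
  by move=> C CV; case/max_independentP: (NM C CV).
split=> //; apply/max_independentP; split=> // M MI.
have [/andP[MV _] /andP[UV _]] := (MI, UI).
rewrite (card_components MV) (card_components UV); apply: leq_sum => C CV.
rewrite UC //; case/max_independentP: (NM C CV) => _; apply.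
exact: independent_sub.
Qed.

(** Exchange argument: a larger independent set of [C] could replace the part of [M] in [C], leaving
    the other components alone. *)
Lemma max_independent_component M C : C \in components V e ->
  M \in max_independent V e -> M :&: C \in max_independent C e.
Proof.
move=> CV /max_independentP[MI Mmax]; apply/max_independentP.
split=> [|M' M'I]; first exact: independent_sub.
pose N D := if D == C then M' else M :&: D.
have [|UI UC] := independent_glue (N := N).
  by move=> D DV; rewrite /N; case: eqP => [->|_] //; apply: independent_sub.
have := Mmax _ UI; have [/andP[MV _] /andP[UV _]] := (MI, UI).
rewrite (card_components MV) (card_components UV).
rewrite (bigD1 C) // [X in (_ <= X)%N](bigD1 C) //= UC // /N eqxx.
suff -> : (\sum_(i in components V e | i != C)
    #|\bigcup_(D in components V e) N D :&: i| =
    \sum_(i in components V e | i != C) #|M :&: i|)%N by rewrite leq_add2r.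
by apply: eq_bigr => D /andP[DV DC]; rewrite UC // /N (negbTE DC).
Qed.

(** Expanding the product gives one term per choice function on the components. These functions
    correspond to the sets [M] by intersecting with each component, with union as the inverse. *)
Lemma sum_max_independent (R : comPzRingType) (w : {set T} -> {set T} -> R) :
  \sum_(M in max_independent V e) \prod_(C in components V e) w C (M :&: C) =
  \prod_(C in components V e) \sum_(Mr in max_independent C e) w C Mr.
Proof.
rewrite (big_distr_big_dep set0) /=.
(* The value [set0] off the components matches the default given to [big_distr_big_dep], whose
   functions are supported on the components. *)
pose h (M : {set T}) : {ffun {set T} -> {set T}} :=
  [ffun C => if C \in components V e then M :&: C else set0].
pose h' (f : {ffun {set T} -> {set T}}) := \bigcup_(C in components V e) f C.
rewrite [RHS](reindex_onto h h') /=; last first.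
  move=> f /pfamilyP[/subsetP fsupp fmax]; have [_ fC] := max_independent_glue fmax.
  apply/ffunP => C; rewrite ffunE; case: ifPn => [CV|CV]; first exact: fC.
  by apply/esym/eqP; apply: contraR CV => /fsupp.
apply: eq_big => [M|M _]; last first.
  by apply: eq_bigr => C CV; rewrite ffunE CV.
have hE C : C \in components V e -> h M C = M :&: C by rewrite ffunE => ->.
apply/idP/andP => [MM|[/pfamilyP[_ hM] /eqP <-]]; last first.
  by case: (max_independent_glue hM).
split.
  apply/pfamilyP; split=> [|C CV]; last first.
    by rewrite hE //; apply: max_independent_component.
  by apply/subsetP => C; rewrite inE ffunE; case: ifP => //; rewrite eqxx.
apply/eqP/setP => x; apply/bigcupP/idP => [[C CV]|xM].
  by rewrite hE // => /setIP[].
have /max_independentP[/andP[MV _] _] := MM.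
have [C CV xC] := component_exists (subsetP MV _ xM).
by exists C => //; rewrite hE // inE xM.
Qed.

End GraphComponents.

(** * Connected order ideals *)

Section LabeledPoset.

Variables (n : nat) (le : rel 'I_n).
Hypotheses (le_refl : reflexive le) (le_anti : antisymmetric le).
Hypothesis le_trans : transitive le.

Implicit Types (I J K S U : {set 'I_n}) (M : {set {set 'I_n}}).

Lemma order_idealP I :
  reflect (forall i j, i \in I -> le j i -> j \in I) (order_ideal le I).
Proof.
apply: (iffP forall_inP) => [H i j iI ji|H i iI].
  by move/forallP/(_ j)/implyP: (H i iI); apply.
by apply/forallP => j; apply/implyP; apply: H.
Qed.

Lemma hasse_in_connect_sym I : connect_sym (hasse_in le I).
Proof.
by apply: sym_connect_sym => x y; rewrite /hasse_in /= andbCA orbC.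
Qed.

(** Strong induction on the size of the interval from [a] to [b]: a pair that is not a cover is
    split at an intermediate element, and both halves span smaller intervals. *)
Lemma connect_hasse_in I a b : order_ideal le I -> b \in I -> le a b ->
  connect (hasse_in le I) a b.
Proof.
move=> /order_idealP idI.
have [k] := ubnP #|[set c | le a c && le c b]|.
elim: k a b => // k IH a b; rewrite ltnS => leK bI ab.
have [->|nab] := eqVneq a b; first exact: connect0.
case: (boolP [exists c, strict le a c && strict le c b]); last first.
  move=> nex; apply: connect1.
  apply/and3P; split; [exact: idI ab | by [] | apply/orP; left].
  by apply/andP; split; [apply/andP|].
case/existsP => c /= /andP[/andP[nac ac] /andP[ncb cb]].
have cI := idI b c bI cb.
apply: (@connect_trans _ _ c); apply: IH => //; apply: leq_trans leK; apply: proper_card;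
  apply/properP; split.
- by apply/subsetP => d; rewrite !inE => /andP[-> /le_trans->].
- exists b; rewrite !inE ?ab ?le_refl //=.
  by apply/negP => bc; case/eqP: ncb; apply: le_anti; rewrite cb.
- by apply/subsetP => d; rewrite !inE => /andP[cd ->]; rewrite (le_trans ac cd).
- exists a; rewrite !inE ?ab ?le_refl ?andbT //=.
  by apply/negP => ca; case/eqP: nac; apply: le_anti; rewrite ac.
Qed.

(** Trades Hasse paths for closure under comparability, which turns connectedness into an induction
    principle. *)
Lemma connected_idealP J : reflect
  [/\ J != set0, order_ideal le J &
      forall S x, x \in J -> x \in S ->
        (forall a b, a \in J -> b \in J -> a \in S -> le a b || le b a -> b \in S) ->
        J \subset S]
  (connected_ideal le J).
Proof.
apply: (iffP and3P) => -[J0 idJ H]; split=> //.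
  move=> S x xJ xS cl; apply/subsetP => y yJ.
  move/forall_inP/(_ x xJ)/forall_inP/(_ y yJ)/connectP: H => [p].
  elim: p x xJ xS => [|z p IH] x xJ xS /=; first by move=> _ ->.
  case/andP => /and3P[_ zJ xz] pp yl; apply: (IH z) => //.
  apply: (cl x) => //.
  by case/orP: xz => /andP[/andP[_ ->] _]; rewrite ?orbT.
apply/forall_inP => i iJ; apply/forall_inP => j jJ.
suff /subsetP/(_ j jJ) : J \subset [set y | connect (hasse_in le J) i y] by rewrite inE.
apply: (H _ i) => //; first by rewrite inE connect0.
move=> a b aJ bJ; rewrite !inE => ia ab; apply: connect_trans ia _.
case/orP: ab => [ab|ba]; first exact: connect_hasse_in.
by rewrite hasse_in_connect_sym; apply: connect_hasse_in.
Qed.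

Definition ideal_component I x := [set y | connect (hasse_in le I) x y].

Lemma mem_ideal_component I x : x \in ideal_component I x.
Proof. by rewrite inE connect0. Qed.

Lemma ideal_component_sub I x : x \in I -> ideal_component I x \subset I.
Proof.
move=> xI; apply/subsetP => y; rewrite inE => /connectP[p].
elim: p x xI => [|z p IH] x xI /=; first by move=> _ ->.
by case/andP => /and3P[_ zI _]; apply: IH.
Qed.

Lemma ideal_component_closed I x a b : order_ideal le I -> a \in I -> b \in I ->
  a \in ideal_component I x -> le a b || le b a -> b \in ideal_component I x.
Proof.
move=> idI aI bI; rewrite !inE => xa ab; apply: connect_trans xa _.
case/orP: ab => [ab|ba]; first exact: connect_hasse_in.
by rewrite hasse_in_connect_sym; apply: connect_hasse_in.
Qed.

Lemma ideal_component_connected I x : order_ideal le I -> x \in I ->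
  connected_ideal le (ideal_component I x).
Proof.
move=> idI xI; have sI := subsetP (ideal_component_sub xI).
apply/connected_idealP; split.
- by apply/set0Pn; exists x; apply: mem_ideal_component.
- apply/order_idealP => i j iC ji.
  apply: (ideal_component_closed idI (sI _ iC)) => //; last by rewrite ji orbT.
  exact: (order_idealP _ idI) (sI _ iC) ji.
move=> S u; rewrite inE => xu uS cl; apply/subsetP => y; rewrite inE => xy.
have : connect (hasse_in le I) u y.
  by apply: connect_trans xy; rewrite hasse_in_connect_sym.
case/connectP=> p; elim: p u xu uS => [|z p IH] u xu uS /=; first by move=> _ ->.
case/andP => uz pp yl; have xz := connect_trans xu (connect1 uz).
apply: (IH z) => //; apply: (cl u); rewrite ?inE //.
by case/and3P: uz => _ _ /orP[] /andP[/andP[_ ->] _]; rewrite ?orbT.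
Qed.

Lemma ideal_component_max I J x : order_ideal le I -> connected_ideal le J ->
  J \subset I -> x \in J -> J \subset ideal_component I x.
Proof.
move=> idI /connected_idealP[_ _ cJ] /subsetP JI xJ; apply: (cJ _ x) => //.
  exact: mem_ideal_component.
move=> a b aJ bJ; apply: ideal_component_closed; [done | exact: JI..].
Qed.

Lemma ideal_component_eq I x y : y \in ideal_component I x ->
  ideal_component I y = ideal_component I x.
Proof.
rewrite inE => xy; apply/setP => z; rewrite !inE.
by rewrite (same_connect (@hasse_in_connect_sym I) xy).
Qed.

Lemma principal_ideal_connected j : connected_ideal le [set i | le i j].
Proof.
apply/connected_idealP; split.
- by apply/set0Pn; exists j; rewrite inE.
- by apply/order_idealP => a b; rewrite !inE => aj /le_trans; apply.
move=> S x; rewrite inE => xj xS cl.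
have jS : j \in S by apply: (cl x); rewrite ?inE ?xj.
by apply/subsetP => y; rewrite inE => yj; apply: (cl j); rewrite ?inE ?yj ?orbT.
Qed.

(** * Independent sets of [G_P] as laminar families *)

Let V := GP_vertices le.
Let e := @GP_edge n.

Lemma GP_edge_sym : ssrbool.symmetric e.
Proof. by move=> A B; rewrite /e /GP_edge /= setIC [X in _ && X]andbC. Qed.

Lemma not_GP_edgeP J K : reflect
  (forall x, x \in J -> x \in K -> J \subset K \/ K \subset J) (~~ e J K).
Proof.
rewrite /e /GP_edge /=; apply: (iffP idP) => [|H].
  move=> + x xJ xK; have -> /= : J :&: K != set0 by apply/set0Pn; exists x; rewrite inE xJ.
  by case: (J \subset K); [left | case: (K \subset J); [right|]].
apply/negP => /and3P[/set0Pn[x /setIP[xJ xK]]].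
by case: (H x xJ xK) => ->.
Qed.

Lemma GP_independentP M : reflect
  ((forall J, J \in M -> connected_ideal le J) /\
   {in M &, forall J K x, x \in J -> x \in K -> J \subset K \/ K \subset J})
  (independent V e M).
Proof.
apply: (iffP (independentP _ _ _)) => -[MV H]; split.
- by move=> J /(subsetP MV); rewrite inE.
- by move=> J K JM KM; apply/not_GP_edgeP/H.
- by apply/subsetP => J JM; rewrite inE; apply: MV.
- by move=> J K JM KM; apply/not_GP_edgeP/H.
Qed.

Lemma connected_ideal_down J x y : connected_ideal le J -> x \in J -> le y x -> y \in J.
Proof. by case/and3P => _ /order_idealP + _; apply. Qed.

Definition child M : rel {set 'I_n} := [rel D J |
  [&& D \in M, J \in M, D \proper J &
      [forall K in M, ~~ ((D \proper K) && (K \proper J))]]].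

Lemma child_mid M D J K : child M D J -> K \in M -> D \subset K -> K \subset J ->
  K = D \/ K = J.
Proof.
case/and4P=> _ _ _ /forall_inP H KM; rewrite !subEproper.
case/predU1P => [->|DK]; first by left.
case/predU1P => [->|KJ]; first by right.
by have := H K KM; rewrite DK KJ.
Qed.

Lemma child_above M K J : K \in M -> J \in M -> K \proper J ->
  exists2 D, child M D J & K \subset D.
Proof.
move=> KM JM KJ.
pose P (D : {set 'I_n}) := [&& D \in M, K \subset D & D \proper J].
have PK : P K by rewrite /P KM subxx KJ.
have [D /and3P[DM KD DJ] maxD] := @arg_maxnP _ K P (fun D : {set 'I_n} => #|D|) PK.
exists D => //; apply/and4P; split=> //; apply/forall_inP => L LM.
apply/negP => /andP[DL LJ].
have /maxD : P L by rewrite /P LM LJ (subset_trans KD (proper_sub DL)).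
by rewrite /= leqNgt proper_card.
Qed.

Lemma child_below M K J : K \in M -> J \in M -> K \proper J ->
  exists2 U, child M K U & U \subset J.
Proof.
move=> KM JM KJ.
pose P (D : {set 'I_n}) := [&& D \in M, K \proper D & D \subset J].
have PK : P J by rewrite /P JM subxx KJ.
have [D /and3P[DM KD DJ] minD] := @arg_minnP _ J P (fun D : {set 'I_n} => #|D|) PK.
exists D => //; apply/and4P; split=> //; apply/forall_inP => L LM.
apply/negP => /andP[KL LD].
have /minD : P L by rewrite /P LM KL (subset_trans (proper_sub LD) DJ).
by rewrite /= leqNgt proper_card.
Qed.

Lemma mem_mu M J x :
  reflect (exists K, [/\ K \in M, K \proper J & x \in K]) (x \in mu M J).
Proof.
apply: (iffP bigcupP) => [[K /andP[]]|[K [KM KJ xK]]]; first by exists K.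
by exists K => //; rewrite KM.
Qed.

(** * Top elements of the members of a laminar family *)

Section Laminar.

Variable M : {set {set 'I_n}}.
Hypothesis M_ind : independent V e M.

(** Otherwise [D] would be closed under comparability inside [J], and connectedness would give
    [J \subset D]. Indeed, an element of [J] above [D] would lie in a smaller member [K] that meets
    [D], and [K] is contained in [D] since [D] is maximal below [J]. *)
Lemma child_meets_top D J : child M D J ->
  exists x y, [/\ x \in D, y \in J :\: mu M J & le x y].
Proof.
case/GP_independentP: M_ind => Mcon Mlam cDJ.
have /and4P[DM JM DJ _] := cDJ.
case: (boolP [exists x, exists y, [&& x \in D, y \in J :\: mu M J & le x y]]).
  by case/existsP => x /existsP[y /and3P[xD yJ xy]]; exists x, y.
move/existsPn => nex; suff : J \subset D by rewrite (negbTE (proper_subn DJ)).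
have /connected_idealP[/set0Pn[x xD] _ _] := Mcon D DM.
have /connected_idealP[_ _ cJ] := Mcon J JM.
apply: (cJ _ x) => //; first exact: (subsetP (proper_sub DJ)).
move=> a b aJ bJ aD /orP[ab|ba]; last exact: connected_ideal_down (Mcon D DM) aD ba.
case: (boolP (b \in mu M J)) => [|bmu]; last first.
  by have /existsP[] := nex a; exists b; rewrite aD inE bmu bJ ab.
case/mem_mu => K [KM KJ bK].
have aK := connected_ideal_down (Mcon K KM) bK ab.
have [DK|/subsetP] := Mlam D K DM KM a aD aK; last exact.
case: (child_mid cDJ KM DK (proper_sub KJ)) => KE; first by rewrite -KE.
by rewrite KE properxx in KJ.
Qed.

Lemma mu_neq J : J \in M -> J :\: mu M J != set0.
Proof.
case/GP_independentP: M_ind => Mcon Mlam JM.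
have /connected_idealP[/set0Pn[x xJ] _ _] := Mcon J JM.
case: (boolP (x \in mu M J)) => [/mem_mu[K [KM KJ _]]|xmu]; last first.
  by apply/set0Pn; exists x; rewrite inE xmu.
have [D cDJ _] := child_above KM JM KJ.
by have [a [b [_ bJ _]]] := child_meets_top cDJ; apply/set0Pn; exists b.
Qed.

Lemma mu_inj J K x : J \in M -> K \in M ->
  x \in J :\: mu M J -> x \in K :\: mu M K -> J = K.
Proof.
case/GP_independentP: M_ind => _ Mlam JM KM.
rewrite !inE => /andP[xmJ xJ] /andP[xmK xK].
have [] := Mlam J K JM KM x xJ xK; rewrite subEproper => /predU1P[//|] pr.
  by case/negP: xmK; apply/mem_mu; exists J.
by case/negP: xmJ; apply/mem_mu; exists K.
Qed.

(** Selecting an element of [J :\: mu M J] for each [J] injects [M] into the labels, whence the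
    bound [n] on independent sets. *)
Let top J := [pick x in J :\: mu M J].

Let topP J : J \in M -> exists2 x, x \in J :\: mu M J & top J = Some x.
Proof.
move=> /mu_neq/set0Pn[x xJ]; rewrite /top; case: pickP => [y yJ|/(_ x)].
  by exists y.
by rewrite xJ.
Qed.

Let top_inj : {in M &, injective top}.
Proof.
move=> J K JM KM; have [x xJ ->] := topP JM; have [y yK ->] := topP KM.
by case=> xy; rewrite xy in xJ; apply: mu_inj xJ yK.
Qed.

Let top_sub : top @: M \subset [set Some x | x : 'I_n].
Proof.
apply/subsetP => _ /imsetP[J JM ->]; have [x _ ->] := topP JM.
exact: imset_f.
Qed.

Let card_Some : #|[set Some x | x : 'I_n]| = n.
Proof. by rewrite card_imset ?cardsT ?card_ord // => x y []. Qed.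

Lemma GP_independent_card : (#|M| <= n)%N.
Proof. by rewrite -(card_in_imset top_inj) -[X in (_ <= X)%N]card_Some subset_leq_card. Qed.

(** With [n] members the selection [top] is a bijection. Any further element [y] of [J :\: mu M J]
    would be selected by some [K], and [mu_inj] forces [K = J], hence [y = x]. *)
Lemma GP_independent_top x : #|M| = n ->
  exists2 J, J \in M & J :\: mu M J = [set x].
Proof.
move=> cM; have topE : top @: M = [set Some x | x : 'I_n].
  by apply/eqP; rewrite eqEcard top_sub card_Some (card_in_imset top_inj) cM /=.
have ex y : exists2 J, J \in M & y \in J :\: mu M J /\ top J = Some y.
  have : Some y \in top @: M by rewrite topE imset_f.
  case/imsetP => J JM; have [z zJ tJ] := topP JM.
  by rewrite tJ => -[->]; exists J.
have [J JM [xJ tJ]] := ex x; exists J => //; apply/setP => y; rewrite [RHS]inE.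
apply/idP/eqP => [yJ|->//].
have [K KM [yK tK]] := ex y.
by have EJK := mu_inj JM KM yJ yK; move: tK; rewrite -EJK tJ => -[].
Qed.

End Laminar.

(** * Maximum independent sets of the graph of connected ideals *)

Section LinearExtension.

Variable r : rel 'I_n.
Hypotheses (r_total : total r) (r_anti : antisymmetric r) (r_trans : transitive r).
Hypothesis r_ext : forall i j, le i j -> r i j.

Let below j := [set i | r i j].

Let r_refl j : r j j.
Proof. by have := r_total j j; rewrite orbb. Qed.

Let below_ideal j : order_ideal le (below j).
Proof. by apply/order_idealP => a b; rewrite !inE => aj /r_ext/r_trans; apply. Qed.

Let mem_below j : j \in below j.
Proof. by rewrite inE r_refl. Qed.

Definition greedy_ideal j := ideal_component [set i | r i j] j.
Definition greedy_family := [set greedy_ideal j | j : 'I_n].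

Lemma greedy_ideal_connected j : connected_ideal le (greedy_ideal j).
Proof. exact: ideal_component_connected (below_ideal j) (mem_below j). Qed.

Lemma greedy_ideal_r i j : i \in greedy_ideal j -> r i j.
Proof. by move=> /(subsetP (ideal_component_sub (mem_below j))); rewrite inE. Qed.

(** The index [j] is recovered as the [r]-greatest element of its greedy ideal. *)
Lemma greedy_ideal_inj : injective greedy_ideal.
Proof.
move=> i j ij; apply: r_anti; apply/andP; split; apply: greedy_ideal_r.
  by rewrite -ij; apply: mem_ideal_component.
by rewrite ij; apply: mem_ideal_component.
Qed.

(** For [r i j], the ideal of [i] is connected and lies below [j], so as soon as it meets the
    component of [j] it is contained in it. *)
Lemma greedy_family_independent : independent V e greedy_family.
Proof.
apply/GP_independentP; split=> [_ /imsetP[j _ ->]|]; first exact: greedy_ideal_connected.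
suff H i j x : r i j -> x \in greedy_ideal i -> x \in greedy_ideal j ->
    greedy_ideal i \subset greedy_ideal j.
  move=> _ _ /imsetP[i _ ->] /imsetP[j _ ->] x xi xj.
  by case/orP: (r_total i j) => [ij|ji]; [left|right]; apply: H xi xj || apply: H xj xi.
move=> ij xi xj; rewrite /(greedy_ideal j) -(ideal_component_eq xj).
apply: (ideal_component_max (below_ideal j)) => //; first exact: greedy_ideal_connected.
by apply/subsetP => y /greedy_ideal_r yi; rewrite inE (r_trans yi ij).
Qed.

Lemma greedy_family_card : #|greedy_family| = n.
Proof. by rewrite card_imset ?cardsT ?card_ord //; apply: greedy_ideal_inj. Qed.

Lemma mem_greedy_top j :
  j \in greedy_ideal j :\: mu greedy_family (greedy_ideal j).
Proof.
rewrite inE mem_ideal_component andbT; apply/negP => /mem_mu[_ [/imsetP[k _ ->] kj jk]].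
have kj' : r k j by apply: greedy_ideal_r (subsetP (proper_sub kj) _ (mem_ideal_component _ _)).
have /r_anti E : r k j && r j k by rewrite kj' greedy_ideal_r.
by rewrite E properxx in kj.
Qed.

End LinearExtension.

Hypothesis le_nat : naturally_labeled le.

Lemma le_ltn i j : le i j -> i != j -> (i < j)%N.
Proof. by move=> ij nij; apply: le_nat; rewrite /strict /= nij. Qed.

(** The bound [n] is attained: natural labeling makes the order of the labels a linear extension,
    and its greedy family has [n] members. *)
Lemma GP_max_independentP M :
  (M \in max_independent V e) = independent V e M && (#|M| == n).
Proof.
apply/max_independentP/andP => [[MI Mmax]|[MI /eqP cM]]; split=> //; last first.
  by move=> M' /GP_independent_card; rewrite cM.
rewrite eqn_leq GP_independent_card //=.
pose r := [rel i j : 'I_n | (i <= j)%N].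
have r_tot : total r by move=> i j; apply: leq_total.
have r_anti : antisymmetric r by move=> i j /anti_leq/val_inj.
have r_tr : transitive r by move=> j i k; apply: leq_trans.
have r_ext i j : le i j -> r i j.
  by have [->|ij] := eqVneq i j; rewrite /= ?leqnn // => /le_ltn/(_ ij)/ltnW.
rewrite -{1}(greedy_family_card r_tot r_anti) Mmax //.
exact: greedy_family_independent.
Qed.

(** * The forest of a maximum independent set *)

Section Maximum.

Variable M : {set {set 'I_n}}.
Hypothesis M_max : M \in max_independent V e.

Let M_ind : independent V e M.
Proof. by move: M_max; rewrite GP_max_independentP => /andP[]. Qed.

Lemma ideal_ofP i :
  ideal_of M i \in M /\ ideal_of M i :\: mu M (ideal_of M i) = [set i].
Proof.
rewrite /ideal_of; case: pickP => [J /andP[JM /eqP] //|].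
move: M_max; rewrite GP_max_independentP => /andP[_ /eqP cM].
have [J JM Ji] := GP_independent_top M_ind i cM.
by move=> /(_ J); rewrite JM Ji eqxx.
Qed.

Lemma ideal_of_in i : ideal_of M i \in M.
Proof. by case: (ideal_ofP i). Qed.

Lemma ideal_of_connected i : connected_ideal le (ideal_of M i).
Proof. by case/GP_independentP: M_ind => H _; apply: H; apply: ideal_of_in. Qed.

Lemma mem_ideal_of_top i : i \in ideal_of M i :\: mu M (ideal_of M i).
Proof. by rewrite (ideal_ofP i).2 set11. Qed.

Lemma mem_ideal_of i : i \in ideal_of M i.
Proof. by have := mem_ideal_of_top i; rewrite inE => /andP[]. Qed.

Lemma ideal_of_eq i J : J \in M -> i \in J :\: mu M J -> ideal_of M i = J.
Proof.
move=> JM iJ; apply: (mu_inj M_ind _ JM) iJ => //; first exact: ideal_of_in.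
exact: mem_ideal_of_top.
Qed.

Lemma ideal_of_inj : injective (ideal_of M).
Proof.
move=> i j ij; have := mem_ideal_of_top i.
by rewrite ij (ideal_ofP j).2 inE => /eqP.
Qed.

Lemma ideal_of_onto J : J \in M -> exists i, ideal_of M i = J.
Proof.
by move=> JM; have /set0Pn[i iJ] := mu_neq M_ind JM; exists i; apply: ideal_of_eq.
Qed.

(** If [i] lies in [J], laminarity leaves only one alternative to inclusion, [J] strictly inside
    [ideal_of M i], and then [i] would be in [mu]. *)
Lemma ideal_of_sub i J : J \in M -> (ideal_of M i \subset J) = (i \in J).
Proof.
move=> JM; apply/idP/idP => [/subsetP->//|iJ]; first exact: mem_ideal_of.
case/GP_independentP: M_ind => _ Mlam.
have [//|] := Mlam _ _ (ideal_of_in i) JM i (mem_ideal_of i) iJ.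
rewrite subEproper => /predU1P[->//|JJ]; have := mem_ideal_of_top i.
by rewrite inE => /andP[/negP[]]; apply/mem_mu; exists J.
Qed.

Lemma coversE i j :
  covers (forest_lt M) i j = child M (ideal_of M i) (ideal_of M j).
Proof.
rewrite /covers /child /= !ideal_of_in /=; congr (_ && _).
rewrite negb_exists; apply/forallP/forall_inP => [H K /ideal_of_onto[k <-]|H k].
  exact: H.
by apply: H; apply: ideal_of_in.
Qed.

(** This is the forest property: the members of [M] containing [ideal_of M i] share the element [i],
    so they form a chain. *)
Lemma covers_uniq i j k :
  covers (forest_lt M) i j -> covers (forest_lt M) i k -> j = k.
Proof.
rewrite !coversE => cj ck; apply: ideal_of_inj.
case/and4P: (cj) => _ _ /properP[/subsetP ij _] _.
case/and4P: (ck) => _ _ /properP[/subsetP ik _] _.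
case/GP_independentP: M_ind => _ Mlam; have ii := mem_ideal_of i.
have [jk|kj] := Mlam _ _ (ideal_of_in j) (ideal_of_in k) i (ij _ ii) (ik _ ii).
  have [E|//] := child_mid ck (ideal_of_in j) (introT subsetP ij) jk.
  by case/and4P: cj; rewrite E properxx.
have [E|//] := child_mid cj (ideal_of_in k) (introT subsetP ik) kj.
by case/and4P: ck; rewrite E properxx.
Qed.

Lemma covers_below i k : ideal_of M i \subset ideal_of M k -> i != k ->
  exists2 j, covers (forest_lt M) i j & ideal_of M j \subset ideal_of M k.
Proof.
move=> ik nik; have pik : ideal_of M i \proper ideal_of M k.
  by move: ik; rewrite subEproper (inj_eq ideal_of_inj) (negbTE nik).
have [U] := child_below (ideal_of_in i) (ideal_of_in k) pik.
move=> cU Uk; have [j jU] : exists j, ideal_of M j = U.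
  by apply: ideal_of_onto; case/and4P: cU.
by exists j; rewrite ?coversE jU.
Qed.

Lemma covers_sub i j : covers (forest_lt M) i j -> ideal_of M i \subset ideal_of M j.
Proof. by rewrite coversE => /and4P[_ _ /proper_sub]. Qed.

(** Induction from the roots downwards: passing to the parent enlarges the ideal, so fewer labels
    remain outside it. *)
Lemma covers_ind (Q : 'I_n -> Prop) :
  (forall i, (forall j, covers (forest_lt M) i j -> Q j) -> Q i) ->
  forall i, Q i.
Proof.
move=> H i; have [k] := ubnP (n - #|ideal_of M i|).
elim: k i => // k IH i; rewrite ltnS => ik; apply: H => j.
rewrite coversE => /and4P[_ _ /proper_card ij _]; apply: IH.
have := subset_leq_card (subsetT (ideal_of M j)); rewrite cardsT card_ord.
by move=> jn; apply: leq_trans ik; rewrite ltn_sub2l // (leq_trans ij).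
Qed.

(** The ideal of [j] is connected and all its elements precede [j], so it lies in the greedy ideal.
    Conversely it is closed under comparability inside the greedy ideal, hence fills it. *)
Lemma greedy_family_uniq (r : rel 'I_n) : total r -> antisymmetric r ->
  transitive r -> (forall i j, ideal_of M i \subset ideal_of M j -> r i j) ->
  M = greedy_family r.
Proof.
move=> r_tot r_anti r_tr Mr.
have r_ext i j : le i j -> r i j.
  move=> ij; apply: Mr; rewrite ideal_of_sub ?ideal_of_in //.
  exact: connected_ideal_down (ideal_of_connected j) (mem_ideal_of j) ij.
case/GP_independentP: (M_ind) => _ Mlam.
suff E j : ideal_of M j = greedy_ideal r j.
  apply/setP => J; apply/idP/imsetP => [/ideal_of_onto[j <-]|[j _ ->]].
    by exists j; rewrite ?E.
  by rewrite -E ideal_of_in.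
have r_refl : r j j by have := r_tot j j; rewrite orbb.
have idI : order_ideal le [set i | r i j].
  by apply/order_idealP => a b; rewrite !inE => aj /r_ext/r_tr; apply.
apply/eqP; rewrite eqEsubset; apply/andP; split.
  apply: ideal_component_max; rewrite ?mem_ideal_of ?ideal_of_connected //.
  by apply/subsetP => i; rewrite -ideal_of_sub ?ideal_of_in // => /Mr; rewrite inE.
have /connected_idealP[_ _] := greedy_ideal_connected r_tot r_tr r_ext j.
apply; [exact: mem_ideal_component | exact: mem_ideal_of |].
move=> a b aG bG aJ /orP[ab|ba]; last first.
  exact: connected_ideal_down (ideal_of_connected j) aJ ba.
(* The ideals of [j] and [b] meet at [a]. If that of [j] is the smaller one, then [j] precedes [b]
   as well as conversely, so [b = j]; otherwise [b] already lies in the ideal of [j]. *)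
have ajb := connected_ideal_down (ideal_of_connected b) (mem_ideal_of b) ab.
have [jb|/subsetP] := Mlam _ _ (ideal_of_in j) (ideal_of_in b) a aJ ajb.
  have bj : r b j by apply: greedy_ideal_r bG.
  by rewrite (r_anti b j) ?mem_ideal_of // bj Mr.
by apply; apply: mem_ideal_of.
Qed.

End Maximum.

(** * Forest partitions *)

(* [m] is a partition of a labeled poset iff this total order extends it. *)
Definition partition_order (m : 'X_{1..n}) : rel 'I_n :=
  [rel i j | (m j < m i)%N || (m j == m i) && (i <= j)%N].

Lemma partition_orderE m i j :
  partition_order m i j = (m j < m i)%N || (m j == m i) && (i <= j)%N.
Proof. by []. Qed.

Lemma partition_order_total m : total (partition_order m).
Proof. by move=> i j; rewrite !partition_orderE; lia. Qed.

Lemma partition_order_anti m : antisymmetric (partition_order m).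
Proof. by move=> i j; rewrite !partition_orderE => H; apply/val_inj => /=; lia. Qed.

Lemma partition_order_trans m : transitive (partition_order m).
Proof. by move=> j i k; rewrite !partition_orderE; lia. Qed.

(** These are the [F_M]-partitions: the strict inequality required when a label exceeds that of an
    ancestor is encoded in the tie-breaking of [partition_order]. *)
Definition forest_partition M (m : 'X_{1..n}) : bool :=
  [forall i, forall j, (ideal_of M i \subset ideal_of M j) ==> partition_order m i j].

Lemma forest_partitionP M m : reflect
  (forall i j, ideal_of M i \subset ideal_of M j -> partition_order m i j)
  (forest_partition M m).
Proof.
apply: (iffP forallP) => [H i j|H i].
  by move/forallP/(_ j)/implyP: (H i).
by apply/forallP => j; apply/implyP/H.
Qed.

Lemma P_partitionP (m : 'X_{1..n}) : reflect (forall i j, le i j -> partition_order m i j)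
  (P_partition le m).
Proof.
apply: (iffP forallP) => [H i j ij|H i].
  have [->|nij] := eqVneq i j; first by rewrite partition_orderE eqxx leqnn orbT.
  move/forallP/(_ j)/implyP: (H i); rewrite /strict /= nij ij partition_orderE => /(_ isT).
  by have := le_ltn ij nij; lia.
apply/forallP => j; apply/implyP => /= /andP[nij ij].
by have := H i j ij; rewrite partition_orderE; have := le_ltn ij nij; lia.
Qed.

Lemma P_partition_sum (m : 'X_{1..n}) :
  (P_partition le m)%:R =
  \sum_(M in max_independent V e) (forest_partition M m)%:R :> int.
Proof.
have r_tot := @partition_order_total m.
have r_anti := @partition_order_anti m.
have r_tr := @partition_order_trans m.
case: (boolP (P_partition le m)) => [/P_partitionP r_ext|nP]; last first.
  rewrite big1 // => M M_max; case: (boolP (forest_partition M m)) => //.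
  (* If [i] is below [j] in P, then [i] lies in the ideal of [j], so the order of every forest
     refines P. *)
  move/forest_partitionP => H; case/P_partitionP: nP => i j ij; apply: H.
  rewrite ideal_of_sub ?ideal_of_in //.
  exact: connected_ideal_down (ideal_of_connected M_max j) (mem_ideal_of M_max j) ij.
pose N := greedy_family (partition_order m).
have N_max : N \in max_independent V e.
  by rewrite GP_max_independentP greedy_family_independent //= greedy_family_card.
rewrite (bigD1 N) //= big1 ?addr0 => [|M /andP[M_max nMN]]; last first.
  case: (boolP (forest_partition M m)) => // /forest_partitionP H.
  by case/eqP: nMN; apply: greedy_family_uniq.
suff -> : forest_partition N m by [].
have NE i : ideal_of N i = greedy_ideal (partition_order m) i.
  apply: ideal_of_eq => //; first exact: imset_f.
  exact: mem_greedy_top.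
apply/forest_partitionP => i j; rewrite !NE => /subsetP/(_ i (mem_ideal_component _ _)).
exact: greedy_ideal_r.
Qed.

Definition set_mnm J : 'X_{1..n} := [multinom (i \in J : nat) | i < n].

Lemma set_mnmE J : \prod_(k in J) mps_var k = mps_mono (set_mnm J).
Proof.
rewrite mps_monoE big_mkcond; apply: eq_bigr => i _.
by rewrite mnmE; case: (i \in J).
Qed.

(** * The generating function of one forest *)

Section ForestSeries.

Variable M : {set {set 'I_n}}.
Hypothesis M_max : M \in max_independent V e.

(** The default 0 makes the coordinate of [m] at a root [i] equal to [m i]. *)
Let parent_val (m : 'X_{1..n}) i : nat :=
  if [pick j | covers (forest_lt M) i j] is Some j then m j else 0.

(* The coordinates of [m] in the basis of indicator vectors of [M]. *)
Let phi (m : 'X_{1..n}) i : int := (m i)%:Z - (parent_val m i)%:Z.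

Let parent_valE m i j : covers (forest_lt M) i j -> parent_val m i = m j.
Proof.
move=> cij; rewrite /parent_val; case: pickP => [k cik|/(_ j)]; last by rewrite cij.
by rewrite (covers_uniq M_max cij cik).
Qed.

Let parent_val0 m i : (forall j, ~~ covers (forest_lt M) i j) -> parent_val m i = 0.
Proof. by move=> nc; rewrite /parent_val; case: pickP => // k; rewrite (negbTE (nc k)). Qed.

Let parent_case i : (exists j, covers (forest_lt M) i j) \/
  (forall j, ~~ covers (forest_lt M) i j).
Proof.
case: (boolP [exists j, covers (forest_lt M) i j]) => [/existsP|/existsPn] H.
  by left.
by right.
Qed.

Let DesE i j : covers (forest_lt M) i j -> (i \in Des M) = (j < i)%N.
Proof.
move=> cij; rewrite inE; apply/existsP/idP => [[k /andP[cik]]|ji].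
  by rewrite (covers_uniq M_max cij cik).
by exists j; rewrite cij.
Qed.

Let Des0 i : (forall j, ~~ covers (forest_lt M) i j) -> (i \in Des M) = false.
Proof.
by move=> nc; rewrite inE; apply/existsP => -[j]; rewrite (negbTE (nc j)).
Qed.

Let phiD m m' i : phi (m + m')%MM i = phi m i + phi m' i.
Proof.
rewrite /phi; case: (parent_case i) => [[j cij]|nc].
  by rewrite !(parent_valE _ cij) !mnmDE; lia.
by rewrite !parent_val0 // !mnmDE; lia.
Qed.

(** The indicator vector of [ideal_of M k] is 1 exactly on the descendants of [k], including [k].
    Its value changes between a node and its parent only at [k]. *)
Let phi_gen i k : phi (set_mnm (ideal_of M k)) i = (i == k)%:R.
Proof.
have E j : set_mnm (ideal_of M k) j = (ideal_of M j \subset ideal_of M k) :> nat.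
  by rewrite mnmE ideal_of_sub ?ideal_of_in.
rewrite /phi E.
have [<-|nik] := eqVneq i k.
  rewrite subxx; case: (parent_case i) => [[j cij]|nc]; last by rewrite parent_val0.
  rewrite (parent_valE _ cij) mnmE; move: cij; rewrite coversE //.
  case/and4P=> _ _ /properP[_ [x xj xi]] _.
  rewrite -(ideal_of_sub M_max) ?ideal_of_in //.
  by case: subsetP => // /(_ x xj); rewrite (negbTE xi).
case: (boolP (_ \subset _)) => [ik|nk].
  have [j cij jk] := covers_below M_max ik nik.
  by rewrite (parent_valE _ cij) E jk.
case: (parent_case i) => [[j cij]|nc]; last by rewrite parent_val0.
rewrite (parent_valE _ cij) E; case: (boolP (_ \subset _)) => // jk.
by rewrite (subset_trans (covers_sub M_max cij) jk) in nk.
Qed.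

Let phi_inj m m' : phi m =1 phi m' -> m = m'.
Proof.
move=> H; apply/mnmP; apply: (covers_ind M_max) => i IH; have := H i; rewrite /phi.
case: (parent_case i) => [[j cij]|nc]; last by rewrite !parent_val0 //; lia.
by rewrite !(parent_valE _ cij) (IH j cij); lia.
Qed.

(** Nonnegative coordinates make [m] weakly increase away from the roots, so positivity at [k]
    spreads to all of [ideal_of M k]. *)
Let phi_ge m k : (forall i, 0 <= phi m i) -> 1 <= phi m k ->
  (set_mnm (ideal_of M k) <= m)%MM.
Proof.
move=> m_ge0 mk; apply/mnm_lepP => i; rewrite mnmE -(ideal_of_sub M_max) ?ideal_of_in //.
have {mk} mk : (0 < m k)%N by move: mk; rewrite /phi; lia.
case: (boolP (_ \subset _)) => //= ik; apply: leq_trans mk _.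
move: i ik; apply: (covers_ind M_max) => i IH ik.
have [->//|nik] := eqVneq i k.
have [j cij jk] := covers_below M_max ik nik.
apply: leq_trans (IH j cij jk) _.
by have := m_ge0 i; rewrite /phi (parent_valE _ cij); lia.
Qed.

(** By transitivity it is enough to compare each node with its parent, where the drop must be at
    least 1 precisely at a descent. *)
Let forest_partitionE m :
  forest_partition M m = [forall i, (i \in Des M)%:R <= phi m i].
Proof.
apply/forest_partitionP/forallP => [H i|H i j].
  rewrite /phi; case: (parent_case i) => [[j cij]|nc]; last first.
    by rewrite parent_val0 // Des0 //; lia.
  have := H i j (covers_sub M_max cij).
  by rewrite partition_orderE (parent_valE _ cij) (DesE cij); lia.
move: i; apply: (covers_ind M_max) => i IH ij.
have [->|nij] := eqVneq i j; first by rewrite partition_orderE eqxx leqnn orbT.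
have [k cik kj] := covers_below M_max ij nij.
apply: (partition_order_trans (y := k)); last exact: IH.
by have := H i; rewrite partition_orderE /phi (parent_valE _ cik) (DesE cik); lia.
Qed.

Lemma forest_series : Mps (fun m => (forest_partition M m)%:R) =
  (\prod_(J in M | [exists i in Des M, J :\: mu M J == [set i]])
     \prod_(k in J) mps_var k)
  / \prod_(J in M) (1 - \prod_(k in J) mps_var k).
Proof.
rewrite [LHS](cone_series (D := Des M) phiD phi_gen phi_inj phi_ge); last first.
  by move=> m; rewrite /= forest_partitionE.
have ofM J : J \in M -> exists i, J = ideal_of M i.
  by move=> /(ideal_of_onto M_max)[i <-]; exists i.
congr (_ / _).
  transitivity (\prod_(J in [set ideal_of M i | i in Des M]) \prod_(k in J) mps_var k).
    rewrite big_imset /=; last by move=> i j _ _; apply: ideal_of_inj.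
    by apply: eq_bigr => i _; rewrite set_mnmE.
  apply: eq_bigl => J; apply/imsetP/andP => [[i iD ->]|[JM /exists_inP[i iD /eqP Ji]]].
    rewrite ideal_of_in //; split=> //; apply/exists_inP; exists i => //.
    by rewrite (ideal_ofP M_max i).2.
  by exists i => //; rewrite (ideal_of_eq M_max JM) // Ji set11.
transitivity (\prod_(J in [set ideal_of M i | i : 'I_n]) (1 - \prod_(k in J) mps_var k)).
  rewrite big_imset /=; last by move=> i j _ _; apply: ideal_of_inj.
  by apply: eq_bigr => i _; rewrite set_mnmE.
apply: eq_bigl => J; apply/imsetP/idP => [[i _ ->]|/ofM[i ->]].
  exact: ideal_of_in.
by exists i.
Qed.

End ForestSeries.

Lemma FP_sum_forests : FP le =
  \sum_(M in max_independent V e)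
    (\prod_(J in M | [exists i in Des M, J :\: mu M J == [set i]])
       \prod_(k in J) mps_var k)
    / \prod_(J in M) (1 - \prod_(k in J) mps_var k).
Proof.
apply/mpsP => m; rewrite mps_coef_sum; apply: etrans (P_partition_sum m) _.
by apply: eq_bigr => M M_max; rewrite -forest_series.
Qed.

(** * Descents within a component *)

Let comps := GP_components le.

Lemma GP_vertexP J : (J \in V) = connected_ideal le J.
Proof. by rewrite inE. Qed.

Lemma component_nested C L K x : C \in comps -> L \in C -> K \in V -> K \notin C ->
  x \in L -> x \in K -> L \subset K \/ K \subset L.
Proof.
move=> CP LC KV KC; apply/not_GP_edgeP; apply: contra KC.
exact: (component_edge GP_edge_sym CP LC KV).
Qed.

(** Inclusion in [K] spreads along edges: a neighbor [B] of some [A] inside [K] is nested with [K],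
    and [K \subset B] would give [A \subset B]. *)
Lemma component_sup C L K : C \in comps -> L \in C -> K \in V -> K \notin C ->
  L \subset K -> forall L', L' \in C -> L' \subset K.
Proof.
move=> CP LC KV KC LK L' L'C.
apply: (component_ind GP_edge_sym (Q := fun L => L \subset K) CP _ LC LK L'C).
move=> A B AC BC /and3P[/set0Pn[x /setIP[xA xB]] nAB _] AK.
have [//|KB] := component_nested CP BC KV KC xB (subsetP AK _ xA).
by rewrite (subset_trans AK KB) in nAB.
Qed.

Lemma child_meets_below M j D : M \in max_independent V e -> child M D (ideal_of M j) ->
  exists2 x, x \in D & le x j.
Proof.
move=> M_max; have /max_independentP[M_ind _] := M_max.
move=> /(child_meets_top M_ind)[x [y [xD]]].
by rewrite (ideal_ofP M_max j).2 inE => /eqP ->; exists x.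
Qed.

Lemma ideal_of_child_not M D j : M \in max_independent V e ->
  child M D (ideal_of M j) -> j \notin D.
Proof.
move=> M_max /and4P[DM _ Dj _]; have := mem_ideal_of_top M_max j.
by rewrite inE => /andP[+ _]; apply: contra => jD; apply/mem_mu; exists D.
Qed.

Lemma ideal_of_split M j x : M \in max_independent V e -> x \in ideal_of M j ->
  x = j \/ exists2 D, child M D (ideal_of M j) & x \in D.
Proof.
move=> M_max xj; case: (boolP (x \in mu M (ideal_of M j))) => [|xmu].
  case/mem_mu => K [KM Kj xK]; right.
  have [D cD /subsetP KD] := child_above KM (ideal_of_in M_max j) Kj.
  by exists D; rewrite ?KD.
by left; apply/set1P; rewrite -(ideal_ofP M_max j).2 inE xmu.
Qed.

(** If [j] were not the top in [M'], it would lie in a child [D] there. An element of [J] below [j]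
    then puts [J] and [D] in contact, so they coincide, although [j] is not in [J]. *)
Lemma ideal_of_common_child M M' J j : M \in max_independent V e ->
  M' \in max_independent V e -> child M J (ideal_of M j) ->
  child M' J (ideal_of M j) -> ideal_of M' j = ideal_of M j.
Proof.
move=> M_max M'_max cJ cJ'; have UM' : ideal_of M j \in M' by case/and4P: cJ'.
have /max_independentP[/GP_independentP[Mcon Mlam] _] := M'_max.
apply: ideal_of_eq => //; rewrite inE mem_ideal_of // andbT.
apply/negP => /mem_mu[K [KM' KU jK]].
have [D cD /subsetP KD] := child_above KM' UM' KU.
have [x xJ xj] := child_meets_below M_max cJ.
have [JM' DM'] : J \in M' /\ D \in M' by case/and4P: cJ'; case/and4P: cD.
have xD := connected_ideal_down (Mcon D DM') (KD _ jK) xj.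
case/negP: (ideal_of_child_not M_max cJ).
suff -> : J = D by apply: KD.
have [DJ JJ] : D \proper ideal_of M j /\ J \proper ideal_of M j.
  by case/and4P: cJ'; case/and4P: cD.
have [JD|DJ'] := Mlam J D JM' DM' x xJ xD.
  have [//|E] := child_mid cJ' DM' JD (proper_sub DJ); by rewrite E properxx in DJ.
have [//|E] := child_mid cD JM' DJ' (proper_sub JJ); by rewrite E properxx in JJ.
Qed.

(* A descent [i > j] forces the principal ideal of [j] to cross [J_i], hence to
   lie in [C]; the parent [J_j] then lies in [C] or is the union of [C], which is
   an isolated vertex and so belongs to every maximum independent set. *)
Lemma descent_local M M' C i j : M \in max_independent V e ->
  M' \in max_independent V e -> C \in comps -> M :&: C = M' :&: C ->
  ideal_of M i \in C -> covers (forest_lt M) i j -> (j < i)%N ->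
  [/\ ideal_of M' i = ideal_of M i, ideal_of M' j = ideal_of M j &
      covers (forest_lt M') i j].
Proof.
move=> M_max M'_max CP MM' JC; rewrite coversE // => cJU ji.
have memMM' K : K \in C -> (K \in M) = (K \in M').
  by move=> KC; have /setP/(_ K) := MM'; rewrite !inE KC !andbT.
have /max_independentP[M_ind _] := M_max.
have /max_independentP[M'_ind M'_card] := M'_max.
have /GP_independentP[Mcon Mlam] := M_ind.
have /GP_independentP[M'con M'lam] := M'_ind.
have MV K : K \in M -> K \in V by move=> /Mcon; rewrite GP_vertexP.
have M'V K : K \in M' -> K \in V by move=> /M'con; rewrite GP_vertexP.
set J := ideal_of M i in JC cJU *; set U := ideal_of M j in cJU *.
have /and4P[JM UM JU _] := cJU.
have JM' : J \in M' by rewrite -memMM'.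
have jJ : j \notin J := ideal_of_child_not M_max cJU.
have [x xJ xj] := child_meets_below M_max cJU.
have nij : ~~ le i j.
  apply/negP => ij; have /le_ltn/(_ _) := ij; rewrite ltnNge (ltnW ji).
  by move=> /(_ _)/negP; apply=> //; rewrite neq_ltn ji orbT.
pose P := [set k | le k j].
have PV : P \in V by rewrite GP_vertexP principal_ideal_connected.
have jP : j \in P by rewrite inE.
have xP : x \in P by rewrite inE.
(* [P] crosses [J]: they share [x], while [i] is not in [P] by natural labeling and [j] is not in
   [J]. *)
have PC : P \in C.
  apply: (component_edge GP_edge_sym CP JC PV); apply/and3P; split.
  - by apply/set0Pn; exists x; rewrite inE xJ.
  - apply/negP => /subsetP/(_ i); rewrite mem_ideal_of // inE (negbTE nij).
    by move/(_ isT).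
  - by apply/negP => /subsetP/(_ j jP); rewrite (negbTE jJ).
(* Each child of [U] meets [P] below [j] and does not contain [j], so a child outside [C] is
   contained in [P]. *)
have coverU : U \notin C -> forall u, u \in U -> exists2 L, L \in C & u \in L.
  move=> UC u uU; have [->|[D cD uD]] := ideal_of_split M_max uU; first by exists P.
  have [y yD yj] := child_meets_below M_max cD.
  have DM : D \in M by case/and4P: cD.
  case: (boolP (D \in C)) => [DC|DC]; first by exists D.
  have [|/subsetP PD|DP] := component_nested CP PC (MV _ DM) DC _ yD.
  - by rewrite inE.
  - by case/negP: (ideal_of_child_not M_max cD); apply: PD.
  - by exists P => //; apply: (subsetP DP).
(* If [U] is outside [C], it is nested with every vertex it meets, so adding it to [M'] keeps
   independence and maximality forces membership. *)
have UM' : U \in M'.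
  case: (boolP (U \in C)) => [UC|UC]; first by rewrite -memMM'.
  have subU := component_sup CP JC (MV _ UM) UC (proper_sub JU).
  have UK K y : K \in V -> y \in U -> y \in K -> U \subset K \/ K \subset U.
    move=> KV yU yK; case: (boolP (K \in C)) => [KC|KC]; first by right; apply: subU.
    have [L LC yL] := coverU UC y yU.
    have [LK|KL] := component_nested CP LC KV KC yL yK; last first.
      by right; apply: subset_trans KL (subU _ LC).
    left; apply/subsetP => z /(coverU UC)[L' L'C zL'].
    by apply: subsetP zL'; apply: component_sup LK _ L'C.
  have : independent V e (U |: M').
    apply/GP_independentP; split=> [K /setU1P[->|/M'con//]|]; first exact: Mcon.
    move=> A B /setU1P[->|AM'] /setU1P[->|BM'] y yA yB; first by left.
    - by apply: UK yA yB; apply: M'V.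
    - by have [] := UK A y (M'V _ AM') yB yA; [right|left].
    - exact: M'lam yA yB.
  by move=> /M'_card; rewrite cardsU1; case: (U \in M') => //; rewrite add1n ltnn.
(* The smallest member [U'] of [M'] above [J] is shared with [M] if it lies in [C]; otherwise it
   contains all of [C], and therefore [U]. *)
have cJU' : child M' J U.
  have [U' cU' U'U] := child_below JM' UM' JU.
  have /and4P[_ U'M' JU' _] := cU'.
  suff -> : U = U' by [].
  case: (boolP (U' \in C)) => [U'C|U'C].
    have U'M : U' \in M by rewrite memMM'.
    have [E|//] := child_mid cJU U'M (proper_sub JU') U'U.
    by rewrite E properxx in JU'.
  have supU' := component_sup CP JC (M'V _ U'M') U'C (proper_sub JU').
  apply/eqP; rewrite eqEsubset U'U andbT.
  case: (boolP (U \in C)) => [/supU'//|UC]; apply/subsetP => u /(coverU UC)[L LC].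
  exact: subsetP (supU' L LC) u.
have Uj : ideal_of M' j = U by apply: ideal_of_common_child cJU'.
have Ji : ideal_of M' i = J.
  apply: ideal_of_eq => //; rewrite inE mem_ideal_of // andbT.
  apply/negP => /mem_mu[K [KM' KJ iK]].
  (* A [K] in [C] would also belong to [M] and put [i] into [mu M J], so [K] comes from another
     component [C']. *)
  have KC : K \notin C.
    apply/negP => KC; have KM : K \in M by rewrite memMM'.
    have := mem_ideal_of_top M_max i; rewrite inE => /andP[/negP i_mu _].
    by apply: i_mu; apply/mem_mu; exists K.
  have [C' C'P KC'] := component_exists GP_edge_sym (M'V _ KM').
  have notC' L : L \in C -> L \notin C'.
    move=> LC; apply/negP => LC'.
    by rewrite (component_eq GP_edge_sym CP C'P LC LC') KC' in KC.
  (* As for [coverU], with [K] and [i] in place of [P] and [j], members of [C'] cover [J]. *)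
  have coverJ y : y \in J -> exists2 L, L \in C' & y \in L.
    move=> yJ; have [->|[D cD yD]] := ideal_of_split M_max yJ; first by exists K.
    have [z zD zi] := child_meets_below M_max cD.
    have DM : D \in M by case/and4P: cD.
    case: (boolP (D \in C')) => [DC|DC]; first by exists D.
    have zK := connected_ideal_down (M'con _ KM') iK zi.
    have [/subsetP KD|DK] := component_nested C'P KC' (MV _ DM) DC zK zD.
      by case/negP: (ideal_of_child_not M_max cD); apply: KD.
    by exists K => //; apply: (subsetP DK).
  have subJ := component_sup C'P KC' (MV _ JM) (notC' _ JC) (proper_sub KJ).
  have [L LC' xL] := coverJ x xJ.
  (* A member [L] of [C'] through [x] is nested with [P]. If [P] is inside, then [j] is in [J]; if
     [L] is inside, so is [K], and [i] is below [j]. Both are impossible. *)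
  have [LP|PL] := component_nested C'P LC' PV (notC' _ PC) xL xP; last first.
    by case/negP: jJ; apply: subsetP jP; apply: subset_trans PL (subJ _ LC').
  have /subsetP/(_ i iK) := component_sup C'P LC' PV (notC' _ PC) LP KC'.
  by rewrite inE (negbTE nij).
by split=> //; rewrite coversE // Ji Uj.
Qed.

(** * Independence of the chosen extension and factorization of the weight *)

Definition descent_ideal M J := [exists i in Des M, J :\: mu M J == [set i]].

Lemma descent_ideal_local M M' C J : M \in max_independent V e ->
  M' \in max_independent V e -> C \in comps -> M :&: C = M' :&: C ->
  J \in M :&: C -> descent_ideal M J = descent_ideal M' J.
Proof.
suff imp N N' : N \in max_independent V e -> N' \in max_independent V e ->
    C \in comps -> N :&: C = N' :&: C -> J \in N :&: C ->
    descent_ideal N J -> descent_ideal N' J.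
  move=> M_max M'_max CP MM' JC; apply/idP/idP; first exact: imp JC.
  by apply: imp => //; rewrite -MM'.
move=> N_max N'_max CP NN' /setIP[JN JC] /exists_inP[i].
rewrite inE => /existsP[j /andP[cij ji]] /eqP JE.
have iJ : ideal_of N i = J by apply: ideal_of_eq => //; rewrite JE set11.
have iC : ideal_of N i \in C by rewrite iJ.
have [i' j' cij'] := descent_local N_max N'_max CP NN' iC cij ji.
apply/exists_inP; exists i; first by rewrite inE; apply/existsP; exists j; rewrite cij'.
by rewrite -iJ -i' (ideal_ofP N'_max i).2.
Qed.

Lemma Desbar_inE M C : Desbar_in M (M :&: C) = [set J in M :&: C | descent_ideal M J].
Proof.
apply/setP => J; rewrite [LHS]in_set [RHS]in_set; case: (boolP (J \in M :&: C)) => //= JC.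
rewrite /descent_ideal; apply/exists_inP/exists_inP => -[i iD JE]; exists i => //.
  by move: iD; rewrite inE => /andP[].
by rewrite inE iD; apply/exists_inP; exists J => //; rewrite eq_sym.
Qed.

Lemma forest_weight_components N
    (Mc : {set {set 'I_n}} -> {set {set 'I_n}} -> {set {set 'I_n}}) :
  extension_choice le Mc -> N \in max_independent V e ->
  (\prod_(J in N | descent_ideal N J) \prod_(k in J) mps_var k)
    / \prod_(J in N) (1 - \prod_(k in J) mps_var k) =
  \prod_(C in comps)
    ((\prod_(J in Desbar_in (Mc C (N :&: C)) (N :&: C)) \prod_(k in J) mps_var k)
      / \prod_(J in N :&: C) (1 - \prod_(j in J) mps_var j)).
Proof.
move=> Mext N_max; have /max_independentP[/andP[NV _] _] := N_max.
(* Members of [N] are nonempty, so their monomials have zero constant term; [prodrV] needs these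
   units to collect the inverses. *)
have unitJ J : J \in N -> 1 - \prod_(k in J) mps_var k \is a GRing.unit.
  move=> /(subsetP NV); rewrite GP_vertexP => /and3P[/set0Pn[x xJ] _ _].
  rewrite set_mnmE; apply: mps_subr_unit => /=; case: eqP => // /mnmP/(_ x).
  by rewrite !mnmE xJ.
rewrite big_split /= prodrV; last first.
  by move=> C _; apply: unitr_prod => J /setIP[/unitJ].
rewrite -(big_components GP_edge_sym _ _ NV) //; congr (_ / _).
rewrite big_mkcondr (big_components GP_edge_sym _ _ NV) //=; apply: eq_bigr => C CP.
have NC := max_independent_component GP_edge_sym CP N_max.
(* The chosen extension [Q] agrees with [N] on [C], so [descent_ideal_local] identifies their
   descents there. *)
have [] := Mext C _ CP NC; move: (Mc C _) => Q Q_max QC.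
rewrite -[in RHS]QC Desbar_inE QC -big_mkcondr /=.
apply: eq_bigl => J; rewrite [RHS]in_set; case: (boolP (J \in N :&: C)) => //= JC.
by apply: (descent_ideal_local (C := C)).
Qed.

End LabeledPoset.

Theorem theorem1p3 (n : nat) (leP : rel 'I_n)
    (leP_refl : reflexive leP) (leP_anti : antisymmetric leP)
    (leP_trans : transitive leP) (leP_nat : naturally_labeled leP)
    (M : {set {set 'I_n}} -> {set {set 'I_n}} -> {set {set 'I_n}})
    (M_ext : extension_choice leP M) :
  FP leP =
  \prod_(C in GP_components leP)
    \sum_(Mr in max_independent C (@GP_edge n))
      (\prod_(J in Desbar_in (M C Mr) Mr) \prod_(k in J) mps_var k)
      / (\prod_(J in Mr) (1 - \prod_(j in J) mps_var j)).
Proof.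
rewrite (FP_sum_forests leP_refl leP_anti leP_trans leP_nat).
rewrite -(sum_max_independent (GP_vertices leP) (@GP_edge_sym n)).
by apply: eq_bigr => N; apply: forest_weight_components.
Qed.
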